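(* Let $\alpha\in\mathbb C\setminus\{0,-1\}$ and let $\mathfrak g=D(2,1,\alpha)$. If $\alpha$ is not rational, then $$J(\mathfrak g)=\{f=c+Qh\mid c\in\mathbb Z,\ h\in\mathbb Z[u_1,u_2,u_3]\}.$$ If $\alpha=p/q$ is rational ($p\in\mathbb Z$, $q\in\mathbb N$ coprime), then $$J(\mathfrak g)=\{f=g(w_\alpha)+Qh\mid h\in\mathbb Z[u_1,u_2,u_3],\ g\in\mathbb Z[w]\}.$$
   Context: For $\mathfrak g=D(2,1,\alpha)$, $\mathfrak g_0=\mathfrak{sl}(2)\oplus\mathfrak{sl}(2)\oplus\mathfrak{sl}(2)$ and $\mathfrak h^*$ has basis $\varepsilon_1,\varepsilon_2,\varepsilon_3$ with $(\varepsilon_1,\varepsilon_1)=-1-\alpha$, $(\varepsilon_2,\varepsilon_2)=1$, $(\varepsilon_3,\varepsilon_3)=\alpha$, other products $0$. Isotropic roots: $\pm\varepsilon_1\pm\varepsilon_2\pm\varepsilon_3$. Weight lattice of $\mathfrak g_0$: $P_0=\mathbb Z\varepsilon_1\oplus\mathbb Z\varepsilon_2\oplus\mathbb Z\varepsilon_3$; $W_0=\mathbb Z_2^3$ changes the signs of the $\varepsilon_i$. Put $x_i=e^{\varepsilon_i}$, $u_i=x_i+x_i^{-1}$. The ring $J(\mathfrak g)=\{f\in\mathbb Z[P_0]^{W_0}: D_\beta f\in(e^\beta-1)\text{ for every isotropic root }\beta\}$ (with $D_\beta e^\lambda=(\beta,\lambda)e^\lambda$ and principal ideals in $\mathbb C[P_0]$)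 is $$J(\mathfrak g)=\Big\{f\in\mathbb Z[x_1^{\pm1},x_2^{\pm1},x_3^{\pm1}]^{\mathbb Z_2^3}\ \Big|\ (1+\alpha)x_1\frac{\partial f}{\partial x_1}+x_2\frac{\partial f}{\partial x_2}+\alpha x_3\frac{\partial f}{\partial x_3}\in(x_1-x_2x_3)\Big\},$$ the ideal being taken in $\mathbb C[x_1^{\pm1},x_2^{\pm1},x_3^{\pm1}]$ and $\mathbb Z_2^3$ acting by $x_i\mapsto x_i^{\pm1}$. Notation: $Q=u_1^2+u_2^2+u_3^2-u_1u_2u_3-4$, and for $\alpha=p/q$ $$w_\alpha=(x_2x_3+x_2^{-1}x_3^{-1}-x_1-x_1^{-1})\frac{(x_2^p-x_2^{-p})(x_3^q-x_3^{-q})}{(x_2-x_2^{-1})(x_3-x_3^{-1})}+x_2^px_3^{-q}+x_2^{-p}x_3^q.$$ *)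

(* Defs.v *)
From HB Require Import structures.
From mathcomp Require Import all_boot all_order all_algebra.
From mathcomp Require Import finmap complex reals.
From mathcomp Require mpoly.
From mathcomp Require Import zify monalg.

Set Implicit Arguments.
Unset Strict Implicit.
Unset Printing Implicit Defensive.

Import GRing.Theory Num.Theory.

Local Open Scope fset_scope.
Local Open Scope ring_scope.

(* Group algebra R[L] of an additive group L: finitely supported sums of      *)
(* formal exponentials << c *g l >> = c e^l, with e^k e^l = e^(k + l).        *)
(* The ring structure that monalg puts on {malg R[K]} is only available when  *)
(* the monoid K has no nontrivial units, so it excludes Laurent monomials;    *)
(* the convolution product below is the same one, for L a group.              *)
Definition groupalg (L : zmodType) (R : comNzRingType) := {malg R[L]}.

Section GroupAlgebra.
Context (L : zmodType) (R : comNzRingType).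

HB.instance Definition _ := GRing.Lmodule.copy (groupalg L R) {malg R[L]}.

Implicit Types (f g : groupalg L R) (k l : L).

(* gexp and gmul are locked to keep unification from computing supports *)
Fact groupalg_key : unit. Proof. by []. Qed.

Definition gexp := locked_with groupalg_key
  (fun k => << 1 *g k >> : groupalg L R).

Lemma gexpE k : gexp k = << 1 *g k >>.
Proof. by rewrite /gexp unlock. Qed.

Definition gmul := locked_with groupalg_key (fun f g =>
  \sum_(k <- msupp f) \sum_(l <- msupp g) << f@_k * g@_l *g k + l >>
  : groupalg L R).

Lemma gmulE f g : gmul f g =
  \sum_(k <- msupp f) \sum_(l <- msupp g) << f@_k * g@_l *g k + l >>.
Proof. by rewrite /gmul unlock. Qed.

Lemma gmulw (d1 d2 : {fset L}) f g : msupp f `<=` d1 -> msupp g `<=` d2 ->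
  gmul f g = \sum_(k <- d1) \sum_(l <- d2) << f@_k * g@_l *g k + l >>.
Proof.
move=> le_d1 le_d2; rewrite !gmulE (big_fset_incl _ le_d1) /=.
  apply/eq_bigr=> k _; apply/big_fset_incl => // l _ /mcoeff_outdom ->.
  by rewrite mulr0 monalgU0.
move=> k _ /mcoeff_outdom fk.
by rewrite big1 => // l _; rewrite fk mul0r monalgU0.
Qed.

Lemma gmulC : commutative gmul.
Proof.
move=> f g; rewrite !gmulE exchange_big /=.
by apply: eq_bigr => l _; apply: eq_bigr => k _; rewrite mulrC addrC.
Qed.

Lemma gmulUU c1 c2 k1 k2 :
  gmul << c1 *g k1 >> << c2 *g k2 >> = << c1 * c2 *g k1 + k2 >>.
Proof. by rewrite (gmulw msuppU_le msuppU_le) !big_seq_fset1 !mcoeffUU. Qed.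

Lemma gmulUg c k g :
  gmul << c *g k >> g = \sum_(l <- msupp g) << c * g@_l *g k + l >>.
Proof.
rewrite (gmulw msuppU_le (fsubset_refl _)) big_seq_fset1.
by apply/eq_bigr => l _; rewrite mcoeffUU.
Qed.

Lemma gmulDl : left_distributive gmul +%R.
Proof.
move=> f1 f2 g; have le := fsubset_refl (msupp g).
rewrite [in RHS](gmulw (fsubsetUl _ (msupp f2)) le).
rewrite [in RHS](gmulw (fsubsetUr (msupp f1) _) le).
rewrite (gmulw (msuppD_le _ _) le) -big_split /=; apply/eq_bigr=> k _.
rewrite -big_split /=; apply/eq_bigr=> l _.
by rewrite mcoeffD mulrDl monalgUD.
Qed.

Lemma gmulDr : right_distributive gmul +%R.
Proof. by move=> g f1 f2; rewrite gmulC gmulDl ![gmul _ g]gmulC. Qed.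

Lemma gmul0g : left_zero 0 gmul.
Proof. by move=> g; rewrite !gmulE msupp0 big_seq_fset0. Qed.

Lemma gmulg0 : right_zero 0 gmul.
Proof. by move=> g; rewrite gmulC gmul0g. Qed.

Lemma gmulA : associative gmul.
Proof.
have suml I (r : seq I) F g :
    gmul (\sum_(k <- r) F k) g = \sum_(k <- r) gmul (F k) g.
  by rewrite (big_morph (gmul^~ g) (fun _ _ => gmulDl _ _ _) (gmul0g _)).
have sumr I (r : seq I) F g :
    gmul g (\sum_(k <- r) F k) = \sum_(k <- r) gmul g (F k).
  by rewrite (big_morph (gmul g) (fun _ _ => gmulDr _ _ _) (gmulg0 _)).
move=> f g h; rewrite [f]monalgE !suml; apply: eq_bigr => k _.
rewrite [g]monalgE sumr !suml sumr; apply: eq_bigr => l _.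
rewrite [h]monalgE !sumr; apply: eq_bigr => m _.
by rewrite !gmulUU mulrA addrA.
Qed.

Lemma gmul1g : left_id (gexp 0) gmul.
Proof.
move=> g; rewrite gexpE gmulUg [RHS]monalgE.
by apply/eq_bigr=> k _; rewrite mul1r add0r.
Qed.

Lemma gexp0_neq0 : gexp 0 != 0.
Proof. by rewrite gexpE monalgU_eq0 oner_eq0. Qed.

HB.instance Definition _ := GRing.Zmodule_isComNzRing.Build (groupalg L R)
  gmulA gmulC gmul1g gmulDl gexp0_neq0.

Lemma gscaleAl c f g : c *: (f * g) = (c *: f) * g.
Proof.
rewrite [LHS](_ : _ = \sum_(k <- msupp f) \sum_(l <- msupp g)
                    << c * (f@_k * g@_l) *g k + l >>); last first.
  apply/malgP=> m; rewrite mcoeffZ [f * g]gmulE !raddf_sum mulr_sumr /=.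
  apply: eq_bigr => k _; rewrite !raddf_sum mulr_sumr /=.
  by apply: eq_bigr => l _; rewrite !mcoeffU mulrnAr.
rewrite [RHS](gmulw (msuppZ_le _ _) (fsubset_refl _)).
by apply: eq_bigr => k _; apply: eq_bigr => l _; rewrite mcoeffZ mulrA.
Qed.

HB.instance Definition _ :=
  GRing.Lmodule_isLalgebra.Build R (groupalg L R) gscaleAl.
HB.instance Definition _ := GRing.Lalgebra_isComAlgebra.Build R (groupalg L R).

Lemma gexpD k l : gexp (k + l) = gexp k * gexp l.
Proof. by rewrite !gexpE [RHS]gmulUU mulr1. Qed.

Lemma gexpM k f l : (gexp k * f)@_l = f@_(l - k).
Proof.
rewrite gexpE [_ * f]gmulUg [in RHS](monalgE f) !raddf_sum /=.
by apply: eq_bigr => m _; rewrite !mcoeffU mul1r addrC eq_sym -subr_eq eq_sym.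
Qed.

Lemma gcoefB f g k : (f - g)@_k = f@_k - g@_k.
Proof. exact: mcoeffB. Qed.

Lemma gcoef0 k : (0 : groupalg L R)@_k = 0.
Proof. exact: mcoeff0. Qed.

Lemma gcoefP f g : (forall k, f@_k = g@_k) -> f = g.
Proof. by move=> fg; apply/malgP. Qed.

(* linear extension of e^l |-> e^(s l) *)
Definition gmap (s : L -> L) f : groupalg L R :=
  \sum_(l <- msupp f) << f@_l *g s l >>.

End GroupAlgebra.

Definition gbase (L : zmodType) (R : comNzRingType) (f : groupalg L int) :
  groupalg L R := \sum_(l <- msupp f) << (f@_l)%:~R *g l >>.

(* P_0 = Z eps_1 + Z eps_2 + Z eps_3 as integer row vectors; the indices      *)
(* 1, 2, 3 are the elements 0, 1, 2 of 'I_3.                                  *)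
Notation P0 := 'rV[int]_3.

Definition eps (i : 'I_3) : P0 := delta_mx 0 i.

Section SuperRing.
Context (R : realType) (alpha : R[i]).

Definition eps_norm (i : 'I_3) : R[i] := [:: - 1 - alpha; 1; alpha]`_i.

Definition bform (la mu : P0) : R[i] :=
  \sum_(i < 3) eps_norm i * (la 0 i)%:~R * (mu 0 i)%:~R.

Lemma bform_eps i j : bform (eps i) (eps j) = if i == j then eps_norm i else 0.
Proof.
rewrite /bform (bigD1 i) //= big1 ?addr0; last first.
  by move=> k /negPf nki; rewrite !mxE nki mulr0 mul0r.
by rewrite !mxE !eqxx mulr1 eq_sym; case: eqP; rewrite ?mulr1 ?mulr0.
Qed.

(* the roots +-eps_1 +-eps_2 +-eps_3, which are the isotropic roots *)
Definition isotropic_root (be : P0) : Prop :=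
  forall i, be 0 i = 1 \/ be 0 i = -1.

Lemma isotropic_root_bform be : isotropic_root be -> bform be be = 0.
Proof.
move=> be1; have sq i : eps_norm i * (be 0 i)%:~R * (be 0 i)%:~R = eps_norm i.
  by case: (be1 i) => ->; rewrite ?mulrN1 ?opprK ?mulr1 // mulrN1 opprK.
rewrite /bform; under eq_bigr => i _ do rewrite sq.
by rewrite !big_ord_recl big_ord0 /eps_norm /= addr0 -opprD addNr.
Qed.

Definition Dder (be : P0) (f : groupalg P0 R[i]) : groupalg P0 R[i] :=
  \sum_(la <- msupp f) << bform be la * f@_la *g la >>.

Definition W0act (s : {ffun 'I_3 -> bool}) (la : P0) : P0 :=
  \row_i ((-1) ^+ s i * la 0 i).

Definition W0_invariant (f : groupalg P0 int) : Prop :=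
  forall s, gmap (W0act s) f = f.

Definition in_J (f : groupalg P0 int) : Prop :=
  W0_invariant f /\
  forall be, isotropic_root be ->
    exists g, Dder be (gbase R[i] f) = (gexp R[i] be - 1) * g.

End SuperRing.

(* x_i ^ n for n in Z *)
Definition xpow (i : 'I_3) (n : int) : groupalg P0 int := gexp int (eps i *~ n).

Definition u (i : 'I_3) : groupalg P0 int := xpow i 1 + xpow i (-1).

Definition Q : groupalg P0 int :=
  u 0 ^+ 2 + u 1 ^+ 2 + u 2 ^+ 2 - u 0 * u 1 * u 2 - 4%:R.

Definition eval_u (h : mpoly.mpoly 3 int) : groupalg P0 int :=
  mpoly.mmap intr u h.

Definition eval_w (w : groupalg P0 int) (g : {poly int}) : groupalg P0 int :=
  (map_poly intr g).[w].

(* The Laurent polynomial (x^n - x^-n) / (x - x^-1), x = x_i: for n >= 0 it   *)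
(* is x^(n-1) + x^(n-3) + ... + x^(1-n), and it is odd in n.  That it is the  *)
(* quotient, and that the quotient is unique, are qnum_quotient and           *)
(* quotient_unique.                                                           *)
Definition qnum (i : 'I_3) (n : int) : groupalg P0 int :=
  (\sum_(k < `|n|%N) xpow i (`|n|%N%:Z - 1 - k%:Z *+ 2)) *~ sgz n.

Lemma xpowD i m n : xpow i (m + n) = xpow i m * xpow i n.
Proof. by rewrite /xpow mulrzDr gexpD. Qed.

Lemma xpowM i n (f : groupalg P0 int) la :
  (xpow i n * f)@_la = f@_(la - eps i *~ n).
Proof. by rewrite /xpow gexpM. Qed.

Lemma qnum_quotient i n :
  (xpow i 1 - xpow i (-1)) * qnum i n = xpow i n - xpow i (- n).
Proof.
have H m : (xpow i 1 - xpow i (-1)) *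
    (\sum_(k < m) xpow i (m%:Z - 1 - k%:Z *+ 2)) =
    xpow i m%:Z - xpow i (- m%:Z).
  rewrite mulr_sumr.
  pose a k := xpow i (m%:Z - k%:Z *+ 2).
  transitivity (\sum_(0 <= k < m) (a k - a k.+1)).
    rewrite big_mkord; apply: eq_bigr => k _.
    rewrite mulrBl -!xpowD /a; congr (xpow i _ - xpow i _).
      by rewrite addrA [1 + _]addrC subrK.
    by rewrite !mulr2n; lia.
  rewrite (eq_bigr (fun k => - (a k.+1 - a k))) => [|k _]; last by rewrite opprB.
  rewrite sumrN telescope_sumr // opprB /a mul0rn subr0.
  by congr (_ - xpow i _); rewrite mulr2n; lia.
rewrite /qnum; case: n => n.
  case: n => [|n]; first by rewrite sgz0 mulr0z mulr0 oppr0 subrr.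
  by rewrite /= mulr1z H.
rewrite NegzE /= mulrN1z mulrN H.
by rewrite opprK opprB.
Qed.

(* x_i - x_i^-1 is not a zero divisor *)
Lemma quotient_unique i (f g : groupalg P0 int) :
  (xpow i 1 - xpow i (-1)) * f = (xpow i 1 - xpow i (-1)) * g -> f = g.
Proof.
move=> /eqP; rewrite -subr_eq0 -mulrBr => /eqP.
move: (f - g) (subr0_eq (x := f) (y := g)) => h hfg h0.
apply: hfg; apply: gcoefP => la; rewrite gcoef0.
have step mu : h@_mu = h@_(mu + eps i *+ 2).
  move: h0; rewrite mulrBl => /(congr1 (fun a => mcoeff (mu + eps i) a)).
  rewrite gcoefB gcoef0 !xpowM mulr1z mulrN1z opprK addrK.
  by move/eqP; rewrite subr_eq0 -addrA -mulr2n => /eqP.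
have steps n : h@_la = h@_(la + eps i *+ 2 *+ n).
  elim: n => [|n ->]; first by rewrite mulr0n addr0.
  by rewrite step -addrA -mulrSr.
have [//|nz] := eqVneq h@_la 0.
pose v n : P0 := la + eps i *+ 2 *+ n.
have vinj : injective v.
  move=> m n /addrI /matrixP /(_ 0 i).
  by rewrite -!mulrnA !mulmxnE !mxE !eqxx /=; lia.
have sub : {subset [seq v n | n <- iota 0 #|` msupp h|.+1] <= msupp h}.
  by move=> ? /mapP[n _ ->]; rewrite -mcoeff_neq0 -steps.
have := uniq_leq_size _ sub; rewrite map_inj_uniq // iota_uniq => /(_ isT).
by rewrite size_map size_iota ltnn.
Qed.

(* w_alpha for alpha = p / q *)
Definition w_alpha (p q : int) : groupalg P0 int :=
  (xpow 1 1 * xpow 2 1 + xpow 1 (-1) * xpow 2 (-1)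
     - xpow 0 1 - xpow 0 (-1)) * (qnum 1 p * qnum 2 q)
  + xpow 1 p * xpow 2 (- q) + xpow 1 (- p) * xpow 2 q.

(* Main.v *)
(* With the indices 0, 1, 2 of the code: an element is divisible by e^be - 1
   iff its image under a projection of P0 along be vanishes.  As be is
   isotropic, D_be commutes with this projection, so the condition on f says
   that the image of f is supported on weights orthogonal to be; by
   W0-invariance be = eps_0 - eps_1 - eps_2 suffices, and the projection is the
   restriction [res] to x_0 = x_1 x_2.  So res f is constant when alpha is
   irrational, and a symmetric Laurent polynomial in t = x_1^p x_2^-q, that is a
   polynomial in t + t^-1 = res w_alpha, when alpha = p / q.  It remains to see
   that an invariant f with res f = 0 is a multiple of Q.  Its remainder modulo
   Q is A + u_0 B with A, B in Z[u_1, u_2]; then A + (x_1 x_2 + x_1^-1 x_2^-1) B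
   vanishes, and so does its image under x_1 |-> x_1^-1, whence
   (x_1 - x_1^-1)(x_2 - x_2^-1) B = 0 and A = B = 0. *)

Require Import Defs.
From HB Require Import structures.
From mathcomp Require Import all_boot all_order all_algebra.
From mathcomp Require Import finmap complex reals.
From mathcomp Require mpoly monalg.
From mathcomp Require Import zify ring.

Set Implicit Arguments.
Unset Strict Implicit.

Import GRing.Theory Num.Theory.

Local Open Scope ring_scope.

(* Projection onto the hyperplane la_0 = 0 along be; for be = beta0 it turns
   x_0 into x_1 x_2. *)
Definition root_proj (be la : P0) : P0 := la - be *~ (be 0 0 * la 0 0).

Definition beta0 : P0 := eps 0 - eps 1 - eps 2.

Notation res := (@gmap _ int (root_proj beta0)).

(* Both monalg and mpoly define the notations _@__ and {mpoly _[_]}. *)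
Section WithoutMpoly.

Import monalg.

(** * Ring morphisms of the group algebra and divisibility by e^be - 1 *)

Section GroupAlgebraMaps.

Variables (L : zmodType) (R : comNzRingType).
Implicit Types (f g : groupalg L R) (s : L -> L).

Lemma gmapw s (d : {fset L}) f : (msupp f `<=` d)%fset ->
  gmap s f = \sum_(l <- d) << f@_l *g s l >>.
Proof.
move=> le_d; rewrite /gmap (big_fset_incl _ le_d) //= => l _ /mcoeff_outdom ->.
by rewrite monalgU0.
Qed.

Lemma gmap_coef s f k :
  (gmap s f)@_k = \sum_(l <- msupp f) f@_l *+ (s l == k).
Proof.
by rewrite /gmap raddf_sum /=; apply: eq_bigr => l _; rewrite mcoeffU.
Qed.

Lemma gmapU s c k : gmap s (<< c *g k >> : groupalg L R) = << c *g s k >>.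
Proof. by rewrite (gmapw s msuppU_le) big_seq_fset1 mcoeffUU. Qed.

Lemma gmap_exp s k : gmap s (gexp R k) = gexp R (s k).
Proof. by rewrite !gexpE gmapU. Qed.

Lemma monalgU_gexp c (k : L) : << c *g k >> = c *: gexp R k.
Proof.
by apply/malgP => l; rewrite mcoeffZ gexpE !mcoeffU mulr_natr.
Qed.

Lemma gmap_zmod_morphism s : zmod_morphism (@gmap L R s).
Proof.
move=> f g.
rewrite (gmapw s (msuppB_le f g)) (gmapw s (fsubsetUl _ (msupp g))).
rewrite (gmapw s (fsubsetUr (msupp f) _)) -sumrB /=; apply: eq_bigr => l _.
by rewrite mcoeffB monalgUB.
Qed.

HB.instance Definition _ s :=
  GRing.isZmodMorphism.Build (groupalg L R) (groupalg L R) (@gmap L R s)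
    (gmap_zmod_morphism s).

Lemma gmap_monoid_morphism (s : {additive L -> L}) :
  monoid_morphism (@gmap L R s).
Proof.
split=> [|f g]; first by rewrite gmap_exp raddf0.
have E (a b : groupalg L R) : a * b = gmul a b by [].
rewrite [in LHS]E gmulE raddf_sum /=.
under eq_bigr => k _.
  rewrite raddf_sum /=.
  under eq_bigr => l _ do rewrite gmapU raddfD -gmulUU -E.
  rewrite -mulr_sumr; over.
by rewrite -mulr_suml.
Qed.

HB.instance Definition _ (s : {additive L -> L}) :=
  GRing.isMonoidMorphism.Build (groupalg L R) (groupalg L R) (@gmap L R s)
    (gmap_monoid_morphism s).

Lemma gmap_comp s1 s2 f : gmap s1 (gmap s2 f) = gmap (s1 \o s2) f.
Proof.
rewrite [gmap s2 f]/gmap raddf_sum /=; apply: eq_bigr => l _.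
by rewrite gmapU.
Qed.

Lemma eq_gmap s1 s2 f : s1 =1 s2 -> gmap s1 f = gmap s2 f.
Proof. by move=> e; apply: eq_bigr => l _; rewrite e. Qed.

Lemma gmap_coef_can (s t : L -> L) f k : cancel s t -> cancel t s ->
  (gmap s f)@_k = f@_(t k).
Proof.
move=> st ts; rewrite gmap_coef [in RHS](monalgE f) raddf_sum /=.
apply: eq_bigr => l _; rewrite mcoeffU; congr (_ *+ nat_of_bool _).
by apply/eqP/eqP => [<-|->]; rewrite ?st ?ts.
Qed.

(** Geometric sum; for n < 0 factor out - e^(n be) first. *)
Lemma gexp_mulrz_sub1 (be : L) (n : int) :
  exists g, gexp R (be *~ n) - 1 = (gexp R be - 1) * g.
Proof.
have H (m : nat) : exists g, gexp R (be *~ m) - 1 = (gexp R be - 1) * g.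
  elim: m => [|m [g IH]]; first by exists 0; rewrite mulr0z mulr0 subrr.
  exists (gexp R (be *~ m) + g); rewrite mulrDr -IH intS mulrzDr mulr1z gexpD.
  by ring.
case: n => m; first exact: H.
have [g Hg] := H m.+1; exists (- gexp R (be *- m.+1) * g).
rewrite mulrCA -Hg mulrBr mulr1 mulNr -gexpD NegzE mulrNz addNr.
by rewrite /GRing.one /=; ring.
Qed.

(** Modulo e^be - 1 each e^l equals e^(phi l), as l - phi l is a multiple of be; so f - [gmap phi f]
    is always divisible. Conversely the ring morphism [gmap phi] kills e^be - 1. *)
Lemma dvd_gexp_sub1 (phi : {additive L -> L}) (be : L) (c : L -> int) :
    phi be = 0 -> (forall l, l - phi l = be *~ c l) ->
  forall f, (exists g, f = (gexp R be - 1) * g) <-> gmap phi f = 0.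
Proof.
move=> phi0 phic f; split=> [[g ->]|f0].
  by rewrite rmorphM rmorphB rmorph1 /= gmap_exp phi0 subrr mul0r.
suff [g Hg] : exists g, f - gmap phi f = (gexp R be - 1) * g.
  by exists g; rewrite -Hg f0 subr0.
rewrite {1}[f]monalgE /gmap -sumrB.
elim/big_rec: _ => [|l _ _ [g ->]]; first by exists 0; rewrite mulr0.
have [h Hh] := gexp_mulrz_sub1 be (c l).
exists (f@_l *: gexp R (phi l) * h + g); rewrite mulrDr; congr (_ + _).
rewrite mulrCA -Hh -phic mulrBr mulr1 -scalerAl -gexpD [phi l + _]addrC subrK.
by rewrite !monalgU_gexp.
Qed.

End GroupAlgebraMaps.

(** * Sign changes and projections along isotropic roots *)

Lemma mxMzE (m n : nat) (V : zmodType) (A : 'M[V]_(m, n)) (k : int) i j :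
  (A *~ k) i j = A i j *~ k.
Proof. by case: k => k; rewrite ?NegzE ?mulrNz ?mxE mulmxnE. Qed.

Lemma W0act_zmod_morphism s : zmod_morphism (W0act s).
Proof. by move=> la mu; apply/rowP => i; rewrite !mxE mulrBr. Qed.

HB.instance Definition _ s :=
  GRing.isZmodMorphism.Build P0 P0 (W0act s) (W0act_zmod_morphism s).

Lemma W0actK s : involutive (W0act s).
Proof. by move=> la; apply/rowP => i; rewrite !mxE signrMK. Qed.

Lemma root_proj_zmod_morphism be : zmod_morphism (root_proj be).
Proof.
move=> la mu; rewrite /root_proj !mxE mulrBr mulrzBr; set a := be *~ _.
by set b := be *~ _; rewrite !opprB [b - a]addrC addrACA [- mu + _]addrC.
Qed.

HB.instance Definition _ be :=
  GRing.isZmodMorphism.Build P0 P0 (root_proj be) (root_proj_zmod_morphism be).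

(** The sign at index 0 enters the coefficient be_0 la_0 twice and cancels. *)
Lemma root_proj_W0 s be la :
  root_proj (W0act s be) (W0act s la) = W0act s (root_proj be la).
Proof.
rewrite /root_proj raddfB raddfMz /= !mxE mulrACA -signr_addb addbb.
by rewrite mul1r.
Qed.

Lemma mcoeff_diag (L : zmodType) (C : comNzRingType) (b : L -> C)
    (F : groupalg L C) k :
  (\sum_(l <- msupp F) << b l * F@_l *g l >> : groupalg L C)@_k = b k * F@_k.
Proof.
rewrite raddf_sum /= [in RHS](monalgE F) !raddf_sum /= mulr_sumr.
apply: eq_bigr => l _; rewrite !mcoeffU.
by case: eqP => [->|_]; rewrite ?mulr1n // !mulr0n mulr0.
Qed.

Lemma beta0E (i : 'I_3) : beta0 0 i = if i == 0 then 1 else -1.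
Proof. by case: i => [[|[|[|i]]] Hi]; rewrite ?mxE. Qed.

Lemma isotropic_beta0 : isotropic_root beta0.
Proof. by move=> i; rewrite beta0E; case: eqP; [left|right]. Qed.

Lemma isotropic_rootE be : isotropic_root be -> exists s, be = W0act s beta0.
Proof.
move=> be1; exists [ffun i => be 0 i != beta0 0 i]; apply/rowP => i.
rewrite mxE ffunE beta0E; case: (be1 i) => ->; case: (i == 0) => //=.
Qed.

(** * Reduction of membership in J to the single root [beta0] *)

Section Criterion.
Variables (R : realType) (alpha : R[i]).
Implicit Types (be la mu : P0) (f : groupalg P0 int).

(** Here be_0 is its own inverse, so be_0 la_0 is the right multiple of be to subtract. *)
Lemma isotropic_root_proj be : isotropic_root be -> root_proj be be = 0.
Proof.
move=> /(_ 0) be0; rewrite /root_proj.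
by case: be0 => ->; rewrite ?mulrNN mulr1 mulr1z subrr.
Qed.

Lemma bform_root_proj be la : isotropic_root be ->
  bform alpha be (root_proj be la) = bform alpha be la.
Proof.
move=> /(isotropic_root_bform alpha) be0; rewrite /root_proj.
set n := be 0 0 * la 0 0.
rewrite -[RHS]subr0 -[X in _ = _ - X](mul0r n%:~R) -be0 /bform mulr_suml -sumrB.
by apply: eq_bigr => i _; rewrite !mxE mxMzE -mulrzr; ring.
Qed.

Lemma bform_W0 s be la :
  bform alpha (W0act s be) (W0act s la) = bform alpha be la.
Proof.
rewrite /bform; apply: eq_bigr => i _; rewrite !mxE.
by case: (s i); rewrite ?mul1r ?expr1 ?mulN1r ?intrN ?mulrNN //; ring.
Qed.

Lemma gbase_coef f mu : (gbase R[i] f)@_mu = (f@_mu)%:~R.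
Proof.
rewrite /gbase raddf_sum /= [in RHS](monalgE f) !raddf_sum /=.
by apply: eq_bigr => l _; rewrite !mcoeffU raddfMn.
Qed.

Lemma Dder_coef be (F : groupalg P0 R[i]) mu :
  (Dder alpha be F)@_mu = bform alpha be mu * F@_mu.
Proof. by rewrite /Dder; exact: mcoeff_diag. Qed.

Lemma gmap_root_proj_Dder be f mu : isotropic_root be ->
  (gmap (root_proj be) (Dder alpha be (gbase R[i] f)))@_mu =
  bform alpha be mu * ((gmap (root_proj be) f)@_mu)%:~R.
Proof.
(* The derivative may have smaller support than f, so both sums are taken over [msupp f]. *)
move=> be1; rewrite (@gmapw _ _ _ (msupp f)); last first.
  apply/fsubsetP => l; rewrite -!mcoeff_neq0 Dder_coef gbase_coef.
  by apply: contra_neq => ->; rewrite mulr0.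
rewrite gmap_coef !raddf_sum /= mulr_sumr; apply: eq_bigr => l _.
rewrite mcoeffU Dder_coef gbase_coef.
case: eqP => [<-|_]; last by rewrite !mulr0n mulr0.
by rewrite !mulr1n bform_root_proj.
Qed.

(** Divisibility means that the projected derivative vanishes. Its coefficients are pairings times
    integers, and in a field of characteristic 0 one of the two factors must vanish. *)
Lemma Dder_dvdP be f : isotropic_root be ->
  (exists g, Dder alpha be (gbase R[i] f) = (gexp R[i] be - 1) * g) <->
  (forall mu, (gmap (root_proj be) f)@_mu != 0 -> bform alpha be mu = 0).
Proof.
move=> be1.
rewrite (@dvd_gexp_sub1 _ _ _ be (fun la => be 0 0 * la 0 0)); last 2 first.
- exact: isotropic_root_proj.
- by move=> la; rewrite /root_proj opprB addrC subrK.
split=> [E mu|H].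
  have := gmap_root_proj_Dder f mu be1; rewrite /= in E *; rewrite E mcoeff0.
  by move/esym/eqP; rewrite mulf_eq0 intr_eq0 => /orP[/eqP|->].
apply/malgP => mu; rewrite mcoeff0 [LHS]gmap_root_proj_Dder //.
have [->|/H ->] := eqVneq ((gmap (root_proj be) f)@_mu) 0; first exact: mulr0.
exact: mul0r.
Qed.

(** Sign changes are transitive on isotropic roots and carry the projection along one root to that
    along another, so invariance of f spreads the condition from [beta0] to all roots. *)
Lemma in_JP f : in_J alpha f <->
  W0_invariant f /\ (forall mu, (res f)@_mu != 0 -> bform alpha beta0 mu = 0).
Proof.
split=> -[fW H]; split=> //.
  by apply/Dder_dvdP; [exact: isotropic_beta0|exact: H isotropic_beta0].
move=> be be1; apply/(Dder_dvdP f be1) => mu.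
have [s ->] := isotropic_rootE be1.
have -> : gmap (root_proj (W0act s beta0)) f = gmap (W0act s) (res f).
  rewrite -[in LHS](fW s) [LHS]gmap_comp [RHS]gmap_comp.
  exact/eq_gmap/root_proj_W0.
rewrite (gmap_coef_can _ _ (W0actK s) (W0actK s)) => /H <-.
by rewrite -(bform_W0 s beta0) W0actK.
Qed.

End Criterion.

(* Otherwise rewriting with gmap_W0_qnum unfolds qnum and becomes very slow. *)
Local Opaque qnum.

(** * Polynomials in one element of the group algebra *)

Lemma eval_wD w (g1 g2 : {poly int}) :
  eval_w w (g1 + g2) = eval_w w g1 + eval_w w g2.
Proof. by rewrite /eval_w rmorphD hornerD. Qed.

Lemma eval_wM w (g1 g2 : {poly int}) :
  eval_w w (g1 * g2) = eval_w w g1 * eval_w w g2.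
Proof. by rewrite /eval_w rmorphM hornerM. Qed.

Lemma eval_wC w c : eval_w w c%:P = c%:~R.
Proof. by rewrite /eval_w map_polyC hornerC. Qed.

Lemma eval_wX w : eval_w w 'X = w.
Proof. by rewrite /eval_w map_polyX hornerX. Qed.

Lemma eval_w_ind w (P : groupalg P0 int -> Prop) :
    (forall c : int, P c%:~R) -> (forall f g, P f -> P g -> P (f + g)) ->
    (forall f g, P f -> P g -> P (f * g)) -> P w ->
  forall g, P (eval_w w g).
Proof.
move=> Pz Pd Pm Pw; elim/poly_ind => [|g c IHg].
  by rewrite -(polyC0 int) eval_wC; exact: (Pz 0).
by rewrite eval_wD eval_wM eval_wX eval_wC; auto.
Qed.

Lemma rmorph_eval_w (phi : {rmorphism groupalg P0 int -> groupalg P0 int}) w g :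
  phi (eval_w w g) = eval_w (phi w) g.
Proof.
elim/poly_ind: g => [|g c IHg].
  by rewrite -(polyC0 int) !eval_wC rmorph_int.
by rewrite !(eval_wD, eval_wM, eval_wX, eval_wC) rmorphD rmorphM IHg rmorph_int.
Qed.

(** * Invariance of u_i, Q and w_alpha under sign changes *)

Lemma W0act_eps s i n : W0act s (eps i *~ n) = eps i *~ ((-1) ^+ s i * n).
Proof.
apply/rowP => j; rewrite !mxE !mxMzE !mxE eqxx; case: eqP => [->|_] /=.
  by rewrite !intz.
by rewrite !mul0rz mulr0.
Qed.

Lemma gmap_W0_xpow s i n :
  gmap (W0act s) (xpow i n) = xpow i ((-1) ^+ s i * n).
Proof. by rewrite /xpow gmap_exp W0act_eps. Qed.

Lemma gmap_W0_u s i : gmap (W0act s) (u i) = u i.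
Proof.
rewrite /u rmorphD /= !gmap_W0_xpow; case: (s i) => //.
by rewrite expr1 !mulN1r opprK addrC.
Qed.

(** Stated for any ring morphism to serve both the sign changes and [res]. *)
Lemma rmorph_Q (phi : {rmorphism groupalg P0 int -> groupalg P0 int}) :
  phi Q = phi (u 0) ^+ 2 + phi (u 1) ^+ 2 + phi (u 2) ^+ 2
    - phi (u 0) * phi (u 1) * phi (u 2) - 4%:R.
Proof. by rewrite /Q 2!rmorphB 2!rmorphD 3!rmorphXn 2!rmorphM rmorph_nat. Qed.

Lemma gmap_W0_Q s : gmap (W0act s) Q = Q.
Proof. by rewrite rmorph_Q /= !gmap_W0_u. Qed.

(** Inverting x_i negates both x_i - x_i^-1 and x_i^n - x_i^-n, hence fixes their quotient, which is
    unique. *)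
Lemma gmap_W0_qnum s i n : gmap (W0act s) (qnum i n) = qnum i n.
Proof.
apply: (@quotient_unique i); rewrite qnum_quotient.
have := congr1 (gmap (W0act s)) (qnum_quotient i n).
rewrite rmorphM !rmorphB /= !gmap_W0_xpow; case: (s i); last by rewrite !mul1r.
rewrite expr1 !mulN1r !opprK => E.
by rewrite -[RHS]opprB -E -mulNr opprB.
Qed.

(* The change of w_alpha under x_2 |-> x_2^-1: the product part varies by
   (x_2^p - x_2^-p)(x_3^q - x_3^-q), which the last two terms compensate. *)
Lemma w_flip (C : comNzRingType) (a a' b b' z x y p p' t t' : C) :
    (a - a') * x = p - p' -> (b - b') * y = t - t' ->
  (a' * b + a * b' - z) * (x * y) + p' * t' + p * t =
  (a * b + a' * b' - z) * (x * y) + p * t' + p' * t.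
Proof.
move=> xE yE; apply/eqP; rewrite -subr_eq0; apply/eqP.
transitivity ((p - p') * (t - t') - (a - a') * x * ((b - b') * y)); first ring.
by rewrite xE yE subrr.
Qed.

(** The terms - x_0 - x_0^-1 are collected into - u_0, whose image is known for the morphisms in
    use. *)
Lemma rmorph_w (phi : {rmorphism groupalg P0 int -> groupalg P0 int}) p q :
  phi (w_alpha p q) =
    (phi (xpow 1 1) * phi (xpow 2 1) + phi (xpow 1 (-1)) * phi (xpow 2 (-1))
       - phi (u 0)) * (phi (qnum 1 p) * phi (qnum 2 q))
    + phi (xpow 1 p) * phi (xpow 2 (- q)) + phi (xpow 1 (- p)) * phi (xpow 2 q).
Proof.
have -> : w_alpha p q = (xpow 1 1 * xpow 2 1 + xpow 1 (-1) * xpow 2 (-1) - u 0)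
    * (qnum 1 p * qnum 2 q) + xpow 1 p * xpow 2 (- q) + xpow 1 (- p) * xpow 2 q.
  by rewrite /w_alpha /u opprD addrA.
by rewrite 2!rmorphD 4!rmorphM rmorphB rmorphD 2!rmorphM.
Qed.

(** Only u_0 involves x_0, and inverting x_1 and x_2 together permutes terms; inverting one of them
    is [w_flip]. *)
Lemma W0_invariant_w p q : W0_invariant (w_alpha p q).
Proof.
move=> s.
(* The identity morphism puts [w_alpha] itself in the collected form. *)
have wE := rmorph_w (@idfun _) p q; rewrite /= in wE.
rewrite [LHS]rmorph_w [RHS]wE /=.
rewrite gmap_W0_u (gmap_W0_qnum s 1 p) (gmap_W0_qnum s 2 q).
rewrite 8!gmap_W0_xpow.
have X := qnum_quotient 1 p; have Y := qnum_quotient 2 q.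
case: (s 1); case: (s 2); rewrite ?expr1 ?expr0 ?mul1r ?mulN1r ?opprK //.
- rewrite [xpow 1 (-1) * xpow 2 (-1) + _]addrC -!addrA; congr (_ + _).
  exact: addrC.
- exact: w_flip.
(* Inverting x_2 alone gives the same expression as inverting x_1 alone, up to the order of
   terms. *)
- rewrite -[RHS](w_flip (u 0) X Y) [xpow 1 (-1) * xpow 2 1 + _]addrC -!addrA.
  by congr (_ + _); exact: addrC.
Qed.

(** * Restriction to x_0 = x_1 x_2 *)

Lemma res_xpow0 n : res (xpow 0 n) = xpow 1 n * xpow 2 n.
Proof.
rewrite /xpow gmap_exp -gexpD; congr gexp; apply/rowP => i.
rewrite !mxE !mxMzE !beta0E !mxE eqxx /= intz mul1r.
by case: i => [[|[|[|i]]] Hi] //=; rewrite !(intz, mul0rz); ring.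
Qed.

Lemma res_xpow i n : i != 0 -> res (xpow i n) = xpow i n.
Proof.
move=> i0; rewrite /xpow gmap_exp; congr gexp.
rewrite /root_proj -[RHS]subr0; congr (_ - _).
by rewrite beta0E mxMzE mxE [_ == i]eq_sym (negPf i0) mul0rz mulr0 mulr0z.
Qed.

Lemma xpowVr i : xpow i 1 * xpow i (-1) = 1.
Proof. by rewrite -xpowD subrr /xpow mulr0z. Qed.

Lemma res_u0 : res (u 0) = xpow 1 1 * xpow 2 1 + xpow 1 (-1) * xpow 2 (-1).
Proof. by rewrite /u rmorphD /= !res_xpow0. Qed.

Lemma res_u i : i != 0 -> res (u i) = u i.
Proof. by move=> i0; rewrite /u rmorphD /= !res_xpow. Qed.

(** As a quadratic in u_0, Q has the roots x_1 x_2 + x_1^-1 x_2^-1 and x_1 x_2^-1 + x_1^-1 x_2;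
    [res] sends u_0 to the first. *)
Lemma res_Q : res Q = 0.
Proof.
rewrite rmorph_Q /=.
rewrite res_u0 !res_u // /u.
by ring: (xpowVr 1) (xpowVr 2).
Qed.

Lemma res_qnum i n : i != 0 -> res (qnum i n) = qnum i n.
Proof.
move=> i0; apply: (@quotient_unique i); rewrite qnum_quotient.
have := congr1 res (qnum_quotient i n).
by rewrite rmorphM !rmorphB /= !res_xpow.
Qed.

(** The first factor of the product in [w_alpha] restricts to 0. *)
Lemma res_w p q : res (w_alpha p q) =
  gexp int (eps 1 *~ p - eps 2 *~ q) + gexp int (- (eps 1 *~ p - eps 2 *~ q)).
Proof.
rewrite rmorph_w /= res_u0 !res_qnum // !res_xpow //.
by rewrite subrr mul0r add0r opprD opprK !gexpD /xpow !mulrNz.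
Qed.

Lemma ord3_ind (P : 'I_3 -> Prop) : P 0 -> P 1 -> P 2 -> forall i, P i.
Proof.
move=> P_0 P_1 P_2 [[|[|[|//]]] Hi].
- by rewrite (_ : Ordinal Hi = 0) //; exact: val_inj.
- by rewrite (_ : Ordinal Hi = 1) //; exact: val_inj.
- by rewrite (_ : Ordinal Hi = 2) //; exact: val_inj.
Qed.

(** * Symmetric Laurent polynomials in one variable *)

Lemma gexp_coef (L : zmodType) (k l : L) : (gexp int k)@_l = (k == l)%:R.
Proof. by rewrite gexpE mcoeffU. Qed.

Lemma scale_intE (c : int) (f : groupalg P0 int) : c *: f = c%:~R * f.
Proof. by rewrite -[c in LHS]intz scaler_int mulrzl. Qed.

(* Sum over the orbit {n v, - n v}: hence 1 and not 2 for n = 0. *)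
Definition orbsum (v : P0) (n : nat) : groupalg P0 int :=
  if n is 0 then 1 else gexp int (v *~ n) + gexp int (- (v *~ n)).

(** Chebyshev recurrence S_(k+2) = w S_(k+1) - S_k for the power sums S_k of e^v and e^-v. *)
Lemma orbsum_eval v n :
  exists g, orbsum v n = eval_w (gexp int v + gexp int (- v)) g.
Proof.
pose w := gexp int v + gexp int (- v).
pose S (k : nat) := gexp int (v *~ k) + gexp int (- (v *~ k)).
have SE k : S k.+2 = w * S k.+1 - S k.
  have vV : gexp int v * gexp int (- v) = 1 by rewrite -gexpD subrr.
  rewrite /S /w !intS !mulrzDr !mulr1z !opprD !gexpD.
  by ring: vV.
have H k : (exists g, S k = eval_w w g) /\ (exists g, S k.+1 = eval_w w g).
  elim: k => [|k [[g1 E1] [g2 E2]]].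
    (* The recurrence starts from S_0 = 2, unlike [orbsum v 0], which is 1 and is treated apart. *)
    split; [exists 2%:P|exists 'X]; rewrite ?eval_wC ?eval_wX /S.
      by rewrite mulr0z oppr0.
    by rewrite mulr1z.
  split; first by exists g2.
  exists ('X * g2 + (-1)%:P * g1).
  by rewrite SE E1 E2 eval_wD !eval_wM eval_wX eval_wC mulN1r.
case: n => [|n]; first by exists 1%:P; rewrite eval_wC.
by case: (H n).
Qed.

Lemma rV_neq0 (v : P0) : v != 0 -> exists i, v 0 i != 0.
Proof.
move=> v0; apply/existsP; apply: contraNT v0 => /existsPn H.
by apply/eqP/rowP => i; rewrite mxE; apply/eqP; rewrite -[_ == _]negbK H.
Qed.

Lemma mulrz_rV_inj (v : P0) : v != 0 -> injective (fun k : int => v *~ k).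
Proof.
move=> /rV_neq0[i vi] k l /rowP/(_ i); rewrite !mxMzE !mulrzz.
exact: mulfI.
Qed.

(** As v is nonzero, n v and - n v differ for n > 0, so no coefficient is 2. *)
Lemma orbsum_coef v n mu : v != 0 ->
  (orbsum v n)@_mu = ((mu == v *~ n) || (mu == - (v *~ n)))%:R.
Proof.
move=> v0; case: n => [|n].
  by rewrite mulr0z oppr0 orbb gexp_coef eq_sym.
rewrite mcoeffD !gexp_coef ![_ == mu]eq_sym.
case: eqP => [->|_] /=; last by rewrite add0r.
rewrite -mulrNz; case: eqP => // /(mulrz_rV_inj v0).
by lia.
Qed.

(** Coordinates are bounded on a finite support, while |n v_i| >= n as soon as v_i is nonzero. *)
Lemma mulrz_support_bound (v : P0) (F : groupalg P0 int) : v != 0 ->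
  exists N : nat, forall n : nat, (N <= n)%N -> F@_(v *~ n) = 0.
Proof.
move=> /rV_neq0[i vi]; exists (\max_(la <- msupp F) `|la 0%R i|%N).+1 => n.
apply: contraTeq; rewrite mcoeff_neq0 -ltnNge ltnS => Fn.
have: (`|(v *~ n : P0) 0%R i|%N <= \max_(la <- msupp F) `|la 0%R i|%N)%N.
  exact: (@leq_bigmax_seq _ _ _ (fun la : P0 => `|la 0%R i|%N) _ Fn).
by apply: leq_trans; rewrite mxMzE mulrzz abszM leq_pmull // absz_gt0.
Qed.

(** Induction on a strict bound N for the degree in e^v: subtracting the top coefficient times an
    orbit sum lowers the bound and keeps the symmetry. *)
Lemma symmetric_eval (v : P0) (F : groupalg P0 int) : v != 0 ->
    (forall mu, F@_(- mu) = F@_mu) ->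
    (forall mu, F@_mu != 0 -> exists k : int, mu = v *~ k) ->
  exists g, F = eval_w (gexp int v + gexp int (- v)) g.
Proof.
move=> v0; have [N] := mulrz_support_bound F v0.
elim: N F => [|N IHN] F FN symF supF.
  exists 0%:P; rewrite eval_wC; apply: gcoefP => mu; rewrite gcoef0.
  have [//|Fmu] := eqVneq (F@_mu) 0.
  have [[n|n] ->] := supF _ Fmu; first exact: FN.
  by rewrite NegzE mulrNz symF FN.
pose c := F@_(v *~ N); pose G := F - c *: orbsum v N.
have cG mu : G@_mu = F@_mu - c * ((mu == v *~ N) || (mu == - (v *~ N)))%:R.
  by rewrite mcoeffB mcoeffZ orbsum_coef.
have [||mu|g Gg] := IHN G.
- move=> n; rewrite cG leq_eqVlt => /orP[/eqP <-|ltNn].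
    by rewrite eqxx mulr1 subrr.
  rewrite FN // -mulrNz !(inj_eq (mulrz_rV_inj v0)).
  by rewrite (_ : _ || _ = false) ?mulr0 ?subrr //; lia.
- by move=> mu; rewrite !cG symF eqr_oppLR eqr_opp orbC.
- rewrite cG; have [->|/supF //] := eqVneq (F@_mu) 0.
  rewrite sub0r oppr_eq0.
  case: (mu =P v *~ N) => [-> _|_ /=]; first by exists N.
  case: (mu =P - (v *~ N)) => [-> _|_].
    by exists (- N%:Z); rewrite mulrNz.
  by rewrite mulr0 eqxx.
have [h Hh] := orbsum_eval v N.
exists (g + c%:P * h).
by rewrite eval_wD eval_wM eval_wC -Gg -Hh /G scale_intE subrK.
Qed.

(** * Generation of the invariants by u_0, u_1, u_2 *)

(** Since g does not involve x_i, the i-th coordinate of mu decides which exponential of the orbit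
    sum can contribute. *)
Lemma orbsum_mul_coef i n (g : groupalg P0 int) (mu : P0) :
    (forall la : P0, la 0 i != 0 -> g@_la = 0) ->
  (orbsum (eps i) n * g)@_mu =
    if `|mu 0%R i|%N == n then g@_(mu - eps i *~ mu 0 i) else 0.
Proof.
move=> gi; have e (k : int) : (eps i *~ k : P0) 0 i = k.
  by rewrite mxMzE !mxE !eqxx /= intz.
case: n => [|n].
  rewrite mul1r absz_eq0; case: eqP => [->|/eqP/gi //].
  by rewrite mulr0z subr0.
rewrite mulrDl mcoeffD !gexpM opprK.
have [E|ne1] := eqVneq (mu 0 i) n.+1%:Z.
  rewrite E eqxx [X in _ + X]gi ?addr0 // !mxE e E; lia.
have [E|ne2] := eqVneq (mu 0 i) (- n.+1%:Z).
  by rewrite E abszN eqxx mulrNz opprK gi ?add0r // !mxE e E; lia.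
have -> : g@_(mu - eps i *~ n.+1) = 0 by apply: gi; rewrite !mxE e subr_eq0.
have -> : g@_(mu + eps i *~ n.+1) = 0 by apply: gi; rewrite !mxE e addr_eq0.
by rewrite addr0; case: eqP => //; move: ne1 ne2 => /eqP ? /eqP ?; lia.
Qed.

(** The sum over the orbit of the weight a; the trailing 1 lets [orbsum_mul_coef] treat all three
    factors alike. *)
Definition orbprod (a : 'I_3 -> nat) : groupalg P0 int :=
  orbsum (eps 0) (a 0) * (orbsum (eps 1) (a 1) * (orbsum (eps 2) (a 2) * 1)).

Lemma orbprod_coef a (mu : P0) :
  (orbprod a)@_mu = [forall i, `|mu 0%R i|%N == a i]%:R.
Proof.
have c0 i (la : P0) : la 0 i != 0 -> (1 : groupalg P0 int)@_la = 0.
  move=> la0; rewrite gexp_coef; case: eqP => // E.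
  by rewrite -E mxE eqxx in la0.
have c2 (la : P0) : (orbsum (eps 2) (a 2) * 1)@_la =
    if `|la 0%R 2%R|%N == a 2
    then (1 : groupalg P0 int)@_(la - eps 2 *~ la 0 2) else 0.
  exact: orbsum_mul_coef (c0 _).
have c1 (la : P0) : (orbsum (eps 1) (a 1) * (orbsum (eps 2) (a 2) * 1))@_la =
    if `|la 0%R 1%R|%N == a 1
    then (orbsum (eps 2) (a 2) * 1)@_(la - eps 1 *~ la 0 1) else 0.
  apply: orbsum_mul_coef => nu nu1; rewrite c2; case: ifP => // _.
  by apply: (c0 1); rewrite !mxE mxMzE !mxE /= mul0rz subr0.
rewrite /orbprod orbsum_mul_coef; last first.
  move=> nu nu1; rewrite c1; case: ifP => // _; rewrite c2; case: ifP => // _.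
  by apply: (c0 0); rewrite !mxE !mxMzE !mxE /= !mul0rz !subr0.
have -> : [forall i, `|mu 0%R i|%N == a i] =
    [&& `|mu 0%R 0%R|%N == a 0, `|mu 0%R 1%R|%N == a 1
      & `|mu 0%R 2%R|%N == a 2].
  apply/forallP/and3P => [H|[H0 H1 H2] i]; first by split.
  by elim/ord3_ind: i.
case: eqP => //= E0; rewrite c1 !mxE !mxMzE !mxE /= mul0rz subr0.
case: eqP => //= E1; rewrite c2 !mxE !mxMzE !mxE /= !mul0rz !subr0.
case: eqP => //= E2.
rewrite gexp_coef; case: eqP => // -[]; apply/rowP => i.
rewrite !mxE !mxMzE !mxE.
by elim/ord3_ind: i; rewrite /= !(mul0rz, intz, subr0, subrr).
Qed.

(** Coefficients of f are constant on orbits, and each orbit has exactly one weight with nonnegative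
    coordinates. *)
Lemma W0_invariant_orbprod (f : groupalg P0 int) : W0_invariant f ->
  f = \sum_(la <- msupp f | [forall i, 0 <= la 0 i])
        f@_la *: orbprod (fun i => `|la 0%R i|%N).
Proof.
move=> fW; apply: gcoefP => mu.
pose nu : P0 := \row_i `|mu 0%R i|%N%:Z.
have -> : f@_mu = f@_nu.
  pose s := [ffun i => mu 0 i < 0].
  rewrite -{1}(fW s) (gmap_coef_can _ _ (W0actK s) (W0actK s)); congr (f@_ _).
  apply/rowP => i; rewrite !mxE ffunE; case: ltrP => [/ltz0_abs|/gez0_abs] ->.
    by rewrite expr1 mulN1r.
  by rewrite mul1r.
rewrite [in LHS](monalgE f) !raddf_sum /= [RHS]big_mkcond /=.
apply: eq_bigr => la _; rewrite mcoeffU.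
case: (boolP [forall i, 0 <= la 0 i]) => [/forallP la0|/forallPn[i la0]].
  rewrite mcoeffZ orbprod_coef mulr_natr; congr (_ *+ nat_of_bool _).
  apply/eqP/forallP => [-> i|H]; first by rewrite mxE.
  by apply/rowP => i; rewrite mxE (eqP (H i)) gez0_abs.
by case: eqP => // E; rewrite E mxE in la0.
Qed.

Lemma u_gexp i : u i = gexp int (eps i) + gexp int (- eps i).
Proof. by rewrite /u /xpow mulr1z mulrN1z. Qed.

(** Orbit products are products of polynomials in the single u_i. The induction form serves both
    generation by the u_i and division by Q. *)
Lemma W0_invariant_ind (P : groupalg P0 int -> Prop) :
    (forall c : int, P c%:~R) -> (forall f g, P f -> P g -> P (f + g)) ->
    (forall f g, P f -> P g -> P (f * g)) -> (forall i, P (u i)) ->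
  forall f, W0_invariant f -> P f.
Proof.
move=> Pz Pd Pm Pu f /W0_invariant_orbprod ->.
apply: big_ind => [|//|la _]; first exact: (Pz 0).
have PT i n : P (orbsum (eps i) n).
  have [g ->] := orbsum_eval (eps i) n.
  by apply: eval_w_ind => //; rewrite -u_gexp.
rewrite scale_intE; apply: (Pm) => //; do 3!apply: (Pm) => //.
exact: (Pz 1).
Qed.

Lemma intr_coef (c : int) (mu : P0) :
  (c%:~R : groupalg P0 int)@_mu = c *+ (0 == mu).
Proof. by rewrite -[c%:~R]mulr1 -scale_intE mcoeffZ gexp_coef mulr_natr. Qed.

(** * Supports orthogonal to [beta0] *)

Section Support.
Variables (R : realType) (alpha : R[i]).

Lemma bform_beta0 (mu : P0) : bform alpha beta0 mu =
  (- 1 - alpha) * (mu 0 0)%:~R - (mu 0 1)%:~R - alpha * (mu 0 2)%:~R.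
Proof.
rewrite /bform !big_ord_recl big_ord0 !beta0E /eps_norm /=.
have -> : lift ord0 ord0 = 1 :> 'I_3 by exact: val_inj.
have -> : lift ord0 (lift ord0 ord0) = 2 :> 'I_3 by exact: val_inj.
by rewrite mulrN1z; ring.
Qed.

Lemma bform_beta0D mu nu :
  bform alpha beta0 (mu + nu) = bform alpha beta0 mu + bform alpha beta0 nu.
Proof. by rewrite !bform_beta0 !mxE !rmorphD /=; ring. Qed.

(** Equivalently the derivation D_beta0 kills f, whence closure under sums and products. *)
Definition beta0_perp (f : groupalg P0 int) : Prop :=
  forall mu, f@_mu != 0 -> bform alpha beta0 mu = 0.

Lemma beta0_perp_int c : beta0_perp c%:~R.
Proof.
move=> mu; rewrite intr_coef; case: (0 =P mu) => [<- _|_ /eqP //].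
by rewrite bform_beta0 !mxE; ring.
Qed.

Lemma beta0_perpD f g : beta0_perp f -> beta0_perp g -> beta0_perp (f + g).
Proof.
move=> Pf Pg mu; rewrite mcoeffD; have [->|/Pf //] := eqVneq (f@_mu) 0.
by rewrite add0r => /Pg.
Qed.

Lemma beta0_perpM f g : beta0_perp f -> beta0_perp g -> beta0_perp (f * g).
Proof.
move=> Pf Pg mu; have [//|mu1] := eqVneq (bform alpha beta0 mu) 0.
case/eqP; rewrite [f * g]gmulE !raddf_sum /= big_seq big1 // => k fk.
rewrite raddf_sum big_seq big1 //= => l gl; rewrite mcoeffU.
case: eqP => // E; rewrite -mcoeff_neq0 in fk; rewrite -mcoeff_neq0 in gl.
by rewrite -E bform_beta0D (Pf _ fk) (Pg _ gl) addr0 eqxx in mu1.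
Qed.

Lemma beta0_perp_eval_w w g : beta0_perp w -> beta0_perp (eval_w w g).
Proof.
move=> Pw; apply: eval_w_ind => //.
- exact: beta0_perp_int.
- exact: beta0_perpD.
- exact: beta0_perpM.
Qed.

Lemma res_coef_neq0 f (mu : P0) : (res f)@_mu != 0 -> mu 0 0 = 0.
Proof.
apply: contra_neq_eq => mu0; rewrite gmap_coef big1 // => l _.
case: eqP => // E; case/eqP: mu0; rewrite -E /root_proj.
by rewrite !mxE mxMzE !beta0E /= mul1r intz subrr.
Qed.

(** The sign change -1 commutes with every additive map, in particular with [root_proj beta0]. *)
Lemma W0_invariant_res f mu : W0_invariant f -> (res f)@_(- mu) = (res f)@_mu.
Proof.
move=> fW; pose s : {ffun 'I_3 -> bool} := [ffun => true].
have sN la : W0act s la = - la.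
  by apply/rowP => i; rewrite !mxE ffunE expr1 mulN1r.
rewrite -sN -(gmap_coef_can _ _ (W0actK s) (W0actK s)) gmap_comp.
have sres : W0act s \o root_proj beta0 =1 root_proj beta0 \o W0act s.
  by move=> la /=; rewrite !sN raddfN.
by rewrite (eq_gmap f sres) -gmap_comp fW.
Qed.

End Support.

(** For mu_0 = 0 orthogonality reads mu_1 + alpha mu_2 = 0; a nonzero mu_2 would make alpha
    rational. *)
Lemma beta0_perp_irrational (R : realType) (alpha : R[i]) f :
    ~ (exists r : rat, alpha = ratr r) -> beta0_perp alpha (res f) ->
  exists c : int, res f = c%:~R.
Proof.
move=> irr fP; exists ((res f)@_0); apply: gcoefP => mu; rewrite intr_coef.
case: eqP => [<- //|mu0]; rewrite mulr0n; apply/eqP.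
apply: contra_notT mu0 => Fmu.
apply/esym.
have mu0 := res_coef_neq0 Fmu; have := fP _ Fmu.
rewrite bform_beta0 mu0 mulr0 sub0r => /eqP.
have [mu2|mu2] := eqVneq (mu 0 2) 0.
  rewrite mu2 mulr0 subr0 oppr_eq0 intr_eq0 => /eqP mu1.
  by apply/rowP; elim/ord3_ind; rewrite mxE.
rewrite -opprD oppr_eq0 addrC addr_eq0 => /eqP E; case: irr.
exists (- (mu 0 1)%:~R / (mu 0 2)%:~R); rewrite fmorph_div rmorphN /= !ratr_int.
by rewrite -E mulfK // intr_eq0.
Qed.

(** Orthogonality reads q mu_1 + p mu_2 = 0; coprimality gives mu_2 = k q, then mu_1 = - k p. *)
Lemma beta0_perp_rational (R : realType) (p : int) (q : nat) f :
    (0 < q)%N -> coprime `|p|%N q ->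
    beta0_perp (p%:~R / q%:R : R[i]) (res f) ->
  forall mu, (res f)@_mu != 0 ->
    exists k : int, mu = (eps 1 *~ p - eps 2 *~ q) *~ k.
Proof.
move=> q0 pq fP mu Fmu; have mu0 := res_coef_neq0 Fmu; have := fP _ Fmu.
rewrite bform_beta0 mu0 mulr0 sub0r => E.
have {}E : q%:Z * mu 0 1 + p * mu 0 2 = 0.
  apply/eqP; rewrite -(intr_eq0 R[i]) rmorphD !rmorphM /=.
  have q0' : q%:R != 0 :> R[i] by rewrite pnatr_eq0 -lt0n.
  (* Multiplying the orthogonality relation by - q clears the denominator and the signs. *)
  apply/eqP; transitivity (- q%:R * 0 : R[i]); last exact: mulr0.
  by rewrite -E; field.
have /dvdzP[k mu2] : (q%:Z %| (mu 0 2)%R)%Z.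
  have qp : coprimez q p by rewrite coprimezE coprime_sym.
  rewrite -(Gauss_dvdzr _ qp).
  by move/eqP: E; rewrite addrC addr_eq0 => /eqP ->; rewrite rpredN dvdz_mulr.
have mu1 : mu 0 1 = - k * p.
  have q0' : q%:Z != 0 by rewrite -lt0n.
  apply: (mulfI q0'); apply/eqP; rewrite -subr_eq0 -[X in _ == X]E mu2.
  by apply/eqP; ring.
exists (- k); apply/rowP => i; rewrite mxMzE !mxE !mxMzE !mxE.
by elim/ord3_ind: i; rewrite /= ?mu0 ?mu1 ?mu2 !(mul0rz, intz, mulrzz); ring.
Qed.

(** The exponents of [res_w] are orthogonal to [beta0] because - p + (p / q) q = 0. *)
Lemma beta0_perp_res_w (R : realType) (p : int) (q : nat) : (0 < q)%N ->
  beta0_perp (p%:~R / q%:R : R[i]) (res (w_alpha p q)).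
Proof.
move=> q0; have q1 : q%:R != 0 :> R[i] by rewrite pnatr_eq0 -lt0n.
have v0 : bform (p%:~R / q%:R : R[i]) beta0 (eps 1 *~ p - eps 2 *~ q) = 0.
  rewrite bform_beta0 !mxE !mxMzE !mxE /= !(mul0rz, intz) subr0 sub0r mulrNz.
  by field.
rewrite res_w; apply: beta0_perpD => mu; rewrite gexp_coef.
  by case: (_ =P mu) => [<- _|_ /eqP].
case: (_ =P mu) => [<- _|_ /eqP //].
have := bform_beta0D (p%:~R / q%:R : R[i]) (eps 1 *~ p - eps 2 *~ q)
  (- (eps 1 *~ p - eps 2 *~ q)).
by rewrite subrr v0 add0r => <-; rewrite bform_beta0 !mxE; ring.
Qed.

End WithoutMpoly.

From mathcomp Require Import mpoly.

(** * Polynomials in u_0, u_1, u_2 and division by Q *)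

Lemma eval_uD (h1 h2 : {mpoly int[3]}) :
  eval_u (h1 + h2) = eval_u h1 + eval_u h2.
Proof. exact: mmapD. Qed.

Lemma eval_uM (h1 h2 : {mpoly int[3]}) :
  eval_u (h1 * h2) = eval_u h1 * eval_u h2.
Proof. by case: (mmap_is_multiplicative u intr) => H _; exact: H. Qed.

Lemma eval_u_int (c : int) : eval_u (c%:MP : {mpoly int[3]}) = c%:~R.
Proof. exact: mmapC. Qed.

Lemma eval_u_var i : eval_u ('X_i : {mpoly int[3]}) = u i.
Proof. by rewrite /eval_u mmapX mmap1U. Qed.

Lemma eval_u_ind (P : groupalg P0 int -> Prop) :
    (forall c : int, P c%:~R) -> (forall f g, P f -> P g -> P (f + g)) ->
    (forall f g, P f -> P g -> P (f * g)) -> (forall i, P (u i)) ->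
  forall h, P (eval_u h).
Proof.
move=> Pz Pd Pm Pu h; rewrite /eval_u /mmap.
apply: big_ind => [|//|m _]; first exact: (Pz 0).
apply: (Pm) => //; apply: big_ind => [|//|i _]; first exact: (Pz 1).
elim: (X in _ ^+ X) => [|n IHn]; first exact: (Pz 1).
by rewrite exprS; exact: Pm.
Qed.

Lemma rmorph_eval_u (phi : {rmorphism groupalg P0 int -> groupalg P0 int}) h :
  (forall i, phi (u i) = u i) -> phi (eval_u h) = eval_u h.
Proof.
move=> phiu.
apply: (eval_u_ind (P := fun F => phi F = F)) => // [c|f g ef eg|f g ef eg].
- by rewrite rmorph_int.
- by rewrite rmorphD /= ef eg.
- by rewrite rmorphM /= ef eg.
Qed.

Lemma W0_invariant_eval_u h : W0_invariant (eval_u h).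
Proof. by move=> s; apply: rmorph_eval_u => i; exact: gmap_W0_u. Qed.

Lemma W0_invariant_eval_uP (f : groupalg P0 int) :
  W0_invariant f -> exists h, f = eval_u h.
Proof.
elim/W0_invariant_ind => [c|_ _ [g ->] [h ->]|_ _ [g ->] [h ->]|i].
- by exists c%:MP; rewrite eval_u_int.
- by exists (g + h); rewrite eval_uD.
- by exists (g * h); rewrite eval_uM.
- by exists 'X_i; rewrite eval_u_var.
Qed.

(* Division by Q, which is monic of degree 2 in u_0, with remainder in
   Z[u_1, u_2] + u_0 Z[u_1, u_2]. *)
Lemma W0_invariant_divQ (f : groupalg P0 int) : W0_invariant f ->
  exists a b h : {mpoly int[3]},
    [/\ res (eval_u a) = eval_u a, res (eval_u b) = eval_u b &
        f = eval_u a + u 0 * eval_u b + Q * eval_u h].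
Proof.
(* Being fixed by [res] expresses that a and b do not involve u_0. *)
elim/W0_invariant_ind.
- move=> c; exists c%:MP, 0, 0.
  by rewrite -mpolyC0 !eval_u_int !rmorph_int mulr0 mulr0 !addr0.
- move=> _ _ [a [b [h [ra rb ->]]]] [a' [b' [h' [ra' rb' ->]]]].
  exists (a + a'), (b + b'), (h + h').
  rewrite !eval_uD !rmorphD /= ra rb ra' rb'; split => //.
  by rewrite !mulrDr; ring.
- move=> _ _ [a [b [h [ra rb ->]]]] [a' [b' [h' [ra' rb' ->]]]].
  (* Here d and e are the coefficients in u_0^2 = Q + d + e u_0, which reduces the product of two
     remainders. *)
  have [d Ed] : exists d, eval_u d = 4%:R - u 1 ^+ 2 - u 2 ^+ 2.
    exists (4%:Z%:MP + (-1)%:MP * ('X_1 * 'X_1 + 'X_2 * 'X_2)).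
    by rewrite eval_uD eval_uM eval_uD !eval_uM !eval_u_var !eval_u_int; ring.
  have [e Ee] : exists e, eval_u e = u 1 * u 2.
    by exists ('X_1 * 'X_2); rewrite eval_uM !eval_u_var.
  have rd : res (eval_u d) = eval_u d.
    by rewrite Ed !rmorphB !rmorphXn rmorph_nat /= !res_u.
  have re : res (eval_u e) = eval_u e by rewrite Ee rmorphM /= !res_u.
  have [k Ek] := W0_invariant_eval_uP gmap_W0_Q.
  exists (a * a' + d * (b * b')), (a * b' + a' * b + e * (b * b')),
    (b * b' + h * (a' + 'X_0 * b' + k * h') + (a + 'X_0 * b) * h').
  rewrite !(eval_uD, eval_uM) !eval_u_var -Ek !(rmorphD, rmorphM) /=.
  rewrite ra rb ra' rb' rd re; split=> //.
  have Q0 : u 0 ^+ 2 = Q + eval_u d + u 0 * eval_u e by rewrite Ed Ee /Q; ring.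
  by ring: Q0.
- move=> i; have [->|i0] := eqVneq i 0.
    exists 0, 1, 0.
    rewrite -mpolyC0 -mpolyC1 !eval_u_int !rmorph_int.
    by rewrite mulr1 mulr0 addr0 add0r.
  exists 'X_i, 0, 0.
  by rewrite -mpolyC0 !eval_u_int !rmorph_int eval_u_var res_u // !mulr0 !addr0.
Qed.

(** * The kernel of the restriction and both inclusions *)

Lemma W0_invariant_res0 (f : groupalg P0 int) :
  W0_invariant f -> res f = 0 -> exists h, f = Q * eval_u h.
Proof.
move=> /W0_invariant_divQ[a [b [h [ra rb ->]]]].
rewrite !rmorphD !rmorphM /= ra rb res_Q mul0r addr0 res_u0 => E.
(* Inverting x_1 alone fixes a and b but not the image of u_0. *)
pose s : {ffun 'I_3 -> bool} := [ffun i => i == 1].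
have := congr1 (gmap (W0act s)) E.
rewrite rmorph0 rmorphD rmorphM rmorphD !rmorphM /= !gmap_W0_xpow !ffunE /=.
rewrite !W0_invariant_eval_u expr0 expr1 !mulN1r !mul1r opprK => E'.
(* The two relations differ by (x_1 - x_1^-1)(x_2 - x_2^-1) b, and neither factor is a zero
   divisor. *)
have b0 : eval_u b = 0.
  apply: (@quotient_unique 2); apply: (@quotient_unique 1); rewrite !mulr0.
  by rewrite -(subrr 0) -{1}E -E'; ring.
by exists h; move: E; rewrite b0 !mulr0 !addr0 => ->; rewrite add0r.
Qed.

(** The difference f - g(w) is invariant and restricts to 0, hence is a multiple of Q. *)
Lemma W0_invariant_res_eval_w (f w : groupalg P0 int) g :
    W0_invariant f -> W0_invariant w -> res f = eval_w (res w) g ->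
  exists h, f = eval_w w g + Q * eval_u h.
Proof.
move=> fW wW E; have [||h Hh] := @W0_invariant_res0 (f - eval_w w g).
- by move=> s; rewrite rmorphB /= rmorph_eval_w /= fW wW.
- by rewrite rmorphB /= rmorph_eval_w /= E subrr.
- by exists h; rewrite -Hh addrC subrK.
Qed.

(** Restriction kills Q h and leaves a polynomial in [res w]. *)
Lemma in_J_eval_w (R : realType) (alpha : R[i]) (w : groupalg P0 int) g h :
    W0_invariant w -> beta0_perp alpha (res w) ->
  in_J alpha (eval_w w g + Q * eval_u h).
Proof.
move=> wW wP; apply/in_JP; split=> [s|].
  rewrite rmorphD rmorphM /= rmorph_eval_w /= wW gmap_W0_Q.
  by rewrite W0_invariant_eval_u.
rewrite rmorphD rmorphM /= res_Q mul0r addr0 rmorph_eval_w.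
exact: beta0_perp_eval_w.
Qed.

Theorem proposition7p10 (R : realType) (alpha : R[i]) :
  alpha != 0 -> alpha != -1 ->
  (~ (exists r : rat, alpha = ratr r) ->
     forall f : groupalg P0 int,
       in_J alpha f <->
       exists (c : int) (h : {mpoly int[3]}), f = c%:~R + Q * eval_u h) /\
  (forall (p : int) (q : nat),
     (0 < q)%N -> coprime `|p|%N q -> alpha = p%:~R / q%:R ->
     forall f : groupalg P0 int,
       in_J alpha f <->
       exists (g : {poly int}) (h : {mpoly int[3]}),
         f = eval_w (w_alpha p q) g + Q * eval_u h).
Proof.
move=> _ _; split=> [irr f|p q q0 pq alphaE f]; split.
- move=> /in_JP[fW /(beta0_perp_irrational irr)[c fc]]; exists c.
  (* A constant is a constant polynomial evaluated at w = 0, so the irrational case uses the same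
     two lemmas. *)
  rewrite -(eval_wC 0); apply: W0_invariant_res_eval_w => //.
    by move=> s; exact: rmorph0.
  by rewrite eval_wC.
- move=> [c [h ->]]; rewrite -(eval_wC 0); apply: in_J_eval_w.
    by move=> s; exact: rmorph0.
  by rewrite rmorph0 => mu; rewrite gcoef0 eqxx.
- move=> /in_JP[fW]; rewrite alphaE => /(beta0_perp_rational q0 pq) supf.
  have v0 : eps 1 *~ p - eps 2 *~ q != 0.
    (* The coordinate at index 2 is - q, which is nonzero. *)
    apply/eqP => /rowP/(_ 2); rewrite !mxE !mxMzE !mxE /= mul0rz intz sub0r.
    move/eqP; rewrite oppr_eq0 => /eqP qE.
    by rewrite -[q]/(`|Posz q|%N) qE in q0.
  have [g Hg] := symmetric_eval v0 (fun mu => W0_invariant_res mu fW) supf.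
  exists g; apply: W0_invariant_res_eval_w => //; first exact: W0_invariant_w.
  by rewrite res_w.
- move=> [g [h ->]]; apply: in_J_eval_w; first exact: W0_invariant_w.
  by rewrite alphaE; exact: beta0_perp_res_w.
Qed.
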